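(* Let $\mathcal{A}$ be a minimally self-adjusting BST algorithm that satisfies the access lemma via the SOL potential. Then there is a constant $C$ such that for every after-tree $A$ produced by $\mathcal{A}$ (for an access to $s$), every element $t>s$ of $A$ has right-depth at most $C$ in $A$ and every element $t<s$ of $A$ has left-depth at most $C$ in $A$.
   Context: Keys are $[n]=\{1,\dots,n\}$. For a BST $T$ on $[n]$ and a node $a$, $T(a)$ denotes the set of keys in the subtree of $T$ rooted at $a$. A weight function is $w:[n]\to\mathbb{R}_{>0}$, with $w(S)=\sum_{a\in S}w(a)$ and $W=w([n])$. The SOL potential is $\Phi_T=\sum_{a\in[n]}\log_2 w(T(a))$. A minimally self-adjusting BST algorithm: when key $s$ is accessed in the current tree $T$, let $P$ be the search path (nodes on the root-to-$s$ path, including $s$). The algorithm replaces $P$ by a BST $A$ on the node set $P$ with root $s$ (the after-tree); the subtrees of $T$ hanging off $P$ are reattached to $A$ in the unique way consistent with key order, giving $T'$. Cost: $|P|$. The algorithm satisfies the access lemma via the SOL potential if there is a constant $c'$ such that for all $n$, all BSTs $T$ on $[n]$, all weight functions $w$, all $s$, and all $T'$ the algorithm can produce when accessing $s$ in $T$: $|P|\le\Phi_T-\Phi_{T'}+c'(1+\log_2\frac{W}{w(s)})$. The right-depth (left-depth) of a node is the number of right-going (left-going) edges on the root-to-node path. *)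

(* Defs.v *)
From mathcomp Require Import all_boot all_order all_algebra.
From mathcomp Require Import reals exp.

Set Implicit Arguments.
Unset Strict Implicit.
Unset Printing Implicit Defensive.
Import Order.TTheory GRing.Theory Num.Theory.

Inductive tree := Leaf | Node (l : tree) (a : nat) (r : tree).

Fixpoint keys (t : tree) : seq nat :=
  if t is Node l a r then keys l ++ a :: keys r else [::].

Fixpoint bst (t : tree) : bool :=
  if t is Node l a r then
    [&& all (fun b => b < a) (keys l), all (fun b => a < b) (keys r),
        bst l & bst r]
  else true.

Definition bst_on (S : seq nat) (t : tree) : Prop := bst t /\ keys t =i S.

(* The key set [n] is {1, ..., n}, not {0, ..., n-1}. *)
Definition key_range (n : nat) : seq nat := iota 1 n.

Definition has_root (s : nat) (t : tree) : Prop :=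
  if t is Node _ a _ then a = s else False.

Fixpoint subtree (a : nat) (t : tree) : tree :=
  if t is Node l b r then
    if a == b then t else if a < b then subtree a l else subtree a r
  else Leaf.

Fixpoint search_path (s : nat) (t : tree) : seq nat :=
  if t is Node l b r then
    b :: (if s == b then [::]
          else if s < b then search_path s l else search_path s r)
  else [::].

Fixpoint right_depth (a : nat) (t : tree) : nat :=
  if t is Node l b r then
    if a == b then 0
    else if a < b then right_depth a l else (right_depth a r).+1
  else 0.

Fixpoint left_depth (a : nat) (t : tree) : nat :=
  if t is Node l b r then
    if a == b then 0
    else if a < b then (left_depth a l).+1 else left_depth a r
  else 0.

(* The subtrees of t hanging off the search path of s, from left to right; empty
   ones are listed as Leaf, so when s is a key of t there is exactly one for each
   of the |P| + 1 gaps determined by the keys of the path P. *)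
Fixpoint hanging (s : nat) (t : tree) : seq tree :=
  if t is Node l b r then
    if s == b then [:: l; r]
    else if s < b then rcons (hanging s l) r else l :: hanging s r
  else [:: Leaf].

(* Replaces the leaves of A, from left to right, by the trees in hs.  The leaves
   of a BST A on P correspond, in this order, to the gaps between the keys of P,
   so this is the only way of attaching [hanging s t] that respects key order. *)
Fixpoint graft (A : tree) (hs : seq tree) : tree :=
  if A is Node l a r then
    let k := (size (keys l)).+1 in
    Node (graft l (take k hs)) a (graft r (drop k hs))
  else head Leaf hs.

Definition reattach (T : tree) (s : nat) (A : tree) : tree :=
  graft A (hanging s T).

Lemma bst_sorted t : bst t = sorted ltn (keys t).
Proof.
elim: t => //= l -> a r ->.
rewrite !(sorted_pairwise ltn_trans) pairwise_cat /= allrel_consr.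
case hl: (all _ (keys l)) => //=; case hr: (all _ (keys r)) => /=; last first.
  by rewrite !andbF.
suff -> : allrel ltn (keys l) (keys r) by [].
apply/allrelP => b c bL cR.
exact: ltn_trans (allP hl _ bL) (allP hr _ cR).
Qed.

Fixpoint path_tree (s : nat) (t : tree) : tree :=
  if t is Node l b r then
    if s == b then Node Leaf b Leaf
    else if s < b then Node (path_tree s l) b Leaf
    else Node Leaf b (path_tree s r)
  else Leaf.

Lemma mem_path_tree s t : keys (path_tree s t) =i search_path s t.
Proof.
elim: t => //= l IHl b r IHr x; case: eqP => // _.
case: ifP => _ /=; last by rewrite !inE IHr.
by rewrite mem_cat IHl !inE orbC.
Qed.

Lemma size_hanging s t : size (hanging s t) = (size (keys (path_tree s t))).+1.
Proof.
elim: t => //= l IHl b r IHr; case: eqP => // _.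
case: ifP => _ /=; last by rewrite IHr.
by rewrite size_rcons IHl size_cat addn1.
Qed.

Lemma graft_path_tree s t : graft (path_tree s t) (hanging s t) = t.
Proof.
elim: t => //= l IHl b r IHr; case: eqP => // _.
case: ifP => _ /=; last by rewrite ?take0 ?drop0 IHr.
rewrite -cats1 -size_hanging take_size_cat // drop_size_cat //=.
by rewrite IHl.
Qed.

Fixpoint interleave (ks : seq nat) (hs : seq tree) : seq nat :=
  keys (head Leaf hs) ++
  (if ks is k :: ks' then k :: interleave ks' (behead hs) else [::]).

Lemma interleave_cat k1 a k2 hs :
  interleave (k1 ++ a :: k2) hs =
  interleave k1 (take (size k1).+1 hs) ++
  a :: interleave k2 (drop (size k1).+1 hs).
Proof.
elim: k1 hs => [|k k1 IH] [|h hs] //=; rewrite ?take0 ?drop0 ?cats0 //.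
  by rewrite IH.
by rewrite IH -catA.
Qed.

Lemma keys_graft A hs : keys (graft A hs) = interleave (keys A) hs.
Proof.
elim: A hs => [|l IHl a r IHr] hs /=; first by rewrite cats0.
by rewrite IHl IHr interleave_cat.
Qed.

Lemma bst_path_tree s t : bst t -> bst (path_tree s t).
Proof.
have sub u : {subset keys (path_tree s u) <= keys u}.
  elim: u => //= l IHl b r IHr x; rewrite mem_cat inE.
  case: ifP => _; [|case: ifP => _]; rewrite /= ?mem_cat !inE ?orbF.
  - by move=> ->; rewrite orbT.
  - by case/orP=> [/IHl|] ->; rewrite ?orbT.
  - by case/orP=> [|/IHr] ->; rewrite ?orbT.
elim: t => //= l IHl b r IHr /and4P[hl hr /IHl bl /IHr br].
case: ifP => // _; case: ifP => _ /=; rewrite ?bl ?br ?andbT.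
  by apply/allP => x /sub; apply: (allP hl).
by apply/allP => x /sub; apply: (allP hr).
Qed.

Lemma keys_reattach T s A :
  bst T -> bst_on (search_path s T) A -> keys (reattach T s A) = keys T.
Proof.
move=> bT [bA memA]; rewrite -{2}(graft_path_tree s T) !keys_graft.
congr interleave; apply: (irr_sorted_eq ltn_trans ltnn).
- by rewrite -bst_sorted.
- by rewrite -bst_sorted bst_path_tree.
- by move=> x; rewrite memA mem_path_tree.
Qed.

Lemma bst_on_reattach S T s A :
  bst_on S T -> bst_on (search_path s T) A -> bst_on S (reattach T s A).
Proof.
by move=> [bT mT] hA; split; rewrite ?bst_sorted keys_reattach // -bst_sorted.
Qed.

(* [after_tree T s A] says that A is a possible after-tree when s is accessed in
   the current tree T.  A relation is used so that the choice may depend on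
   anything, e.g. on the access history or on random bits. *)
Record msa_algorithm := MsaAlgorithm {
  after_tree : tree -> nat -> tree -> Prop;
  after_tree_ex : forall (n : nat) (T : tree) (s : nat),
    bst_on (key_range n) T -> s \in key_range n -> exists A, after_tree T s A;
  after_treeP : forall (n : nat) (T : tree) (s : nat) (A : tree),
    bst_on (key_range n) T -> s \in key_range n -> after_tree T s A ->
    bst_on (search_path s T) A /\ has_root s A
}.

Local Open Scope ring_scope.

Definition log2 (R : realType) (x : R) : R := ln x / ln 2.

(* Used only on duplicate-free lists, where it is the weight of a set of keys. *)
Definition weight (R : realType) (w : nat -> R) (S : seq nat) : R :=
  \sum_(a <- S) w a.

Definition sol_potential (R : realType) (n : nat) (w : nat -> R) (T : tree) : R :=
  \sum_(a <- key_range n) log2 (weight w (keys (subtree a T))).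

Definition access_lemma_via_sol (R : realType) (alg : msa_algorithm) : Prop :=
  exists c' : R,
  forall (n : nat) (T : tree) (w : nat -> R) (s : nat) (A : tree),
    bst_on (key_range n) T ->
    (forall a, a \in key_range n -> 0 < w a) ->
    s \in key_range n ->
    after_tree alg T s A ->
    (size (search_path s T))%:R <=
      sol_potential n w T - sol_potential n w (reattach T s A)
      + c' * (1 + log2 (weight w (key_range n) / w s)).

(* Main.v *)
(** Let t be a node of the search path of s, and suppose that r proper
    descendants of t in the before-tree T become ancestors of t in the
    after-tree.  Give weight 1 to the proper descendants of t in T and a huge
    weight D to all other keys.  As D tends to infinity with T fixed, each of
    these r nodes gains log D of potential, the potential of every other node
    drops by at most O(1), and log(W/w(s)) is at most log D + O(1); the access
    lemma therefore forces r <= c'.  Finally, if s < t, every node of the path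
    with key in [s, t) lies below t in T, and the nodes that contribute to the
    right-depth of t in A are of this kind; the case t < s is symmetric. *)
Require Import Defs.
From mathcomp Require Import all_boot all_order all_algebra.
From mathcomp Require Import reals exp.
From mathcomp Require Import lra.

Set Implicit Arguments.
Unset Strict Implicit.
Unset Printing Implicit Defensive.
Import Order.TTheory GRing.Theory Num.Theory.

(** * Subtrees and search paths in a BST *)

Lemma bst_uniq T : bst T -> uniq (keys T).
Proof. by rewrite bst_sorted; apply: sorted_uniq ltn_trans ltnn _. Qed.

Lemma subtree_sub a T : {subset keys (subtree a T) <= keys T}.
Proof.
elim: T => //= l IHl b r IHr x; case: eqP => // _.
by case: ifP => _ => [/IHl|/IHr] h; rewrite mem_cat inE h ?orbT.
Qed.

Lemma bst_subtree a T : bst T -> bst (subtree a T).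
Proof.
elim: T => //= l IHl b r IHr bT; case: eqP => // _.
by case/and4P: bT => _ _ bl br; case: ifP => _; [apply: IHl|apply: IHr].
Qed.

Lemma mem_node l b r a : bst (Node l b r) -> a \in keys (Node l b r) ->
  [\/ a = b, a < b /\ a \in keys l | b < a /\ a \in keys r].
Proof.
move=> /= /and4P[hl hr _ _]; rewrite mem_cat inE => /or3P[al|/eqP ab|ar].
- by constructor 2; rewrite (allP hl _ al).
- by constructor 1.
- by constructor 3; rewrite (allP hr _ ar).
Qed.

Lemma mem_subtree_root a T : bst T -> a \in keys T -> a \in keys (subtree a T).
Proof.
elim: T => //= l IHl b r IHr bT aT; case: eqP => // nab.
case/and4P: (bT) => _ _ bl br.
case: (mem_node bT aT) => [//|[-> al]|[ba ar]]; first exact: IHl.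
by rewrite ltnNge ltnW //=; exact: IHr.
Qed.

Lemma subtree_trans T a b : bst T -> b \in keys (subtree a T) ->
  {subset keys (subtree b T) <= keys (subtree a T)}.
Proof.
elim: T => //= l IHl c r IHr bT.
case: (eqVneq a c) => [_ _ x|nac].
  by have := @subtree_sub b (Node l c r) x.
case/and4P: bT => hl hr bl br.
case: ifP => _ hb.
  have lbc := allP hl _ (subtree_sub hb).
  by rewrite lbc ltn_eqF //; exact: IHl.
have lcb := allP hr _ (subtree_sub hb).
by rewrite gtn_eqF // ltnNge ltnW //=; exact: IHr.
Qed.

(** Follow the searches until the current root is [a] or [b]: the child subtree holding the other
    key omits the root key. *)
Lemma subtree_antisym T a b : bst T -> a \in keys T ->
  b \in keys (subtree a T) -> a \in keys (subtree b T) -> a = b.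
Proof.
elim: T => //= l IHl c r IHr bT.
case/and4P: (bT) => hl hr bl br.
move=> aT; case: (mem_node bT aT) => [->|[lac al]|[lca ar]].
- rewrite eqxx; case: (eqVneq b c) => // nbc _.
  by case: ifP => _ /subtree_sub; [move/(allP hl)|move/(allP hr)]; rewrite ltnn.
- rewrite (ltn_eqF lac) lac => hb.
  have lbc := allP hl _ (subtree_sub hb).
  by rewrite (ltn_eqF lbc) lbc; exact: IHl.
- rewrite (gtn_eqF lca) ltnNge (ltnW lca) /= => hb.
  have lcb := allP hr _ (subtree_sub hb).
  by rewrite (gtn_eqF lcb) ltnNge (ltnW lcb) /=; exact: IHr.
Qed.

Lemma search_path_sub s T : {subset search_path s T <= keys T}.
Proof.
elim: T => //= l IHl b r IHr x; rewrite inE mem_cat inE.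
case/orP=> [->|]; first by rewrite orbT.
by case: eqP => // _; case: ifP => _ => [/IHl|/IHr] ->; rewrite ?orbT.
Qed.

Lemma search_path_uniq s T : bst T -> uniq (search_path s T).
Proof.
elim: T => //= l IHl b r IHr /and4P[hl hr bl br].
case: eqP => // _; case: ifP => _; rewrite ?IHl ?IHr // andbT.
  by apply/negP => /search_path_sub /(allP hl); rewrite ltnn.
by apply/negP => /search_path_sub /(allP hr); rewrite ltnn.
Qed.

Lemma mem_subtree_search_path t u T : bst T -> t \in keys T ->
  u \in search_path t T -> t \in keys (subtree u T).
Proof.
elim: T => //= l IHl b r IHr bT tT.
case/and4P: (bT) => hl hr bl br.
rewrite inE; case: (eqVneq u b) => [//|nub] /=.
case: (mem_node bT tT) => [->|[ltb tl]|[lbt tr]].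
- by rewrite eqxx.
- rewrite (ltn_eqF ltb) ltb => up.
  by rewrite (allP hl _ (search_path_sub up)); exact: IHl.
- rewrite (gtn_eqF lbt) ltnNge (ltnW lbt) /= => up.
  by rewrite ltnNge (ltnW (allP hr _ (search_path_sub up))) /=; exact: IHr.
Qed.

(** A path node above [t] has [s] and [t] on the same side, so its key cannot lie between them;
    every path node from [t] onwards lies in the subtree of [t]. *)
Lemma search_path_between T s t u : bst T ->
  t \in search_path s T -> u \in search_path s T ->
  (s <= u < t) || (t < u <= s) -> u \in keys (subtree t T).
Proof.
elim: T => //= l IHl b r IHr /and4P[hl hr bl br].
rewrite !inE; case: (eqVneq t b) => [<- _|ntb /=].
  case/orP=> [/eqP->|]; first by rewrite mem_cat inE eqxx orbT.
  case: eqP => // _; case: ifP => _ /search_path_sub h _.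
    by rewrite mem_cat h.
  by rewrite mem_cat inE h !orbT.
case: (ltngtP s b) => [sb|bs|//] tp; have tk := search_path_sub tp.
  have tb := allP hl _ tk; rewrite tb.
  case/orP=> [/eqP->|up]; last exact: IHl.
  by rewrite [b < t]ltnNge (ltnW tb) [b <= s]leqNgt sb !andbF.
have bt := allP hr _ tk; rewrite [t < b]ltnNge (ltnW bt) /=.
case/orP=> [/eqP->|up]; last exact: IHr.
by rewrite [s <= b]leqNgt bs [t < b]ltnNge (ltnW bt).
Qed.

(** * Ancestors and depths in the after-tree *)

Lemma keys_sub_graft A hs : {subset keys A <= keys (graft A hs)}.
Proof.
elim: A hs => //= l IHl a r IHr hs x; rewrite !mem_cat !inE.
by case/or3P=> [/IHl|/eqP|/IHr] ->; rewrite ?eqxx ?orbT.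
Qed.

(** Grafting only replaces leaves, so ancestors in the after-tree remain ancestors in the whole new
    tree. *)
Lemma subtree_graft u A hs : bst A -> u \in keys A ->
  {subset keys (subtree u A) <= keys (subtree u (graft A hs))}.
Proof.
elim: A hs => // l IHl b r IHr hs bA uA.
case/and4P: (bA) => _ _ bl br.
case: (mem_node bA uA) => [->|[lub ul]|[lbu ur]] x.
- by rewrite /= eqxx; apply: (@keys_sub_graft (Node l b r)).
- by rewrite /= (ltn_eqF lub) lub; exact: IHl.
- by rewrite /= (gtn_eqF lbu) ltnNge (ltnW lbu) /=; exact: IHr.
Qed.

(** The edge leaving an ancestor [u] of [t] goes right exactly when [u < t]. Depth thus becomes the
    length of a list of ancestors. *)
Lemma right_depthE t A : bst A -> t \in keys A ->
  right_depth t A = size [seq u <- search_path t A | u < t].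
Proof.
elim: A => //= l IHl b r IHr bA tA; case/and4P: (bA) => _ _ bl br.
case: (mem_node bA tA) => [->|[ltb tl]|[lbt tr]].
- by rewrite eqxx ltnn.
- by rewrite (ltn_eqF ltb) ltb ltnNge (ltnW ltb) /= IHl.
- by rewrite (gtn_eqF lbt) lbt ltnNge (ltnW lbt) /= IHr.
Qed.

Lemma left_depthE t A : bst A -> t \in keys A ->
  left_depth t A = size [seq u <- search_path t A | t < u].
Proof.
elim: A => //= l IHl b r IHr bA tA; case/and4P: (bA) => _ _ bl br.
case: (mem_node bA tA) => [->|[ltb tl]|[lbt tr]].
- by rewrite eqxx ltnn.
- by rewrite (ltn_eqF ltb) ltb /= IHl.
- by rewrite (gtn_eqF lbt) ltnNge (ltnW lbt) /= IHr.
Qed.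

(** After the root [s], the search for [t] stays on the side of [s] that contains [t]. *)
Lemma search_path_root s t u A : bst A -> has_root s A ->
  u \in search_path t A -> (s < t -> s <= u) /\ (t < s -> u <= s).
Proof.
case: A => //= l b r /and4P[hl hr _ _] bs; rewrite {}bs inE in hl hr *.
case/orP=> [/eqP->|]; first by rewrite leqnn.
case: (ltngtP t s) => // _ /search_path_sub h; split=> // _.
  exact: ltnW (allP hl _ h).
exact: ltnW (allP hr _ h).
Qed.

(** * Logarithms, weights and the change of potential *)

Section Potential.
Local Open Scope ring_scope.
Variable R : realType.
Implicit Types (w : nat -> R) (S : seq nat).

Lemma ln2_gt0 : 0 < ln 2 :> R.
Proof. by rewrite ln_gt0 // ltr1n. Qed.

Lemma ler_log2 (x y : R) : 0 < x -> x <= y -> log2 x <= log2 y.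
Proof.
move=> x0 xy; rewrite ler_pM2r ?invr_gt0 ?ln2_gt0 // ler_ln ?posrE //.
exact: lt_le_trans xy.
Qed.

Lemma log2M (x y : R) : 0 < x -> 0 < y -> log2 (x * y) = log2 x + log2 y.
Proof. by move=> x0 y0; rewrite /log2 lnM ?posrE // mulrDl. Qed.

Lemma log2_exp (m : nat) : log2 (2 ^+ m : R) = m%:R.
Proof.
by rewrite /log2 lnXn // mulrnAl divff // gt_eqF // ln2_gt0.
Qed.

Lemma weight_ge w S a : (forall b, 0 <= w b) -> a \in S -> w a <= weight w S.
Proof.
by move=> w0 aS; rewrite /weight (big_rem a aS) /= lerDl sumr_ge0.
Qed.

Lemma weight_le w S (n : nat) (d : R) : 0 <= d -> (size S <= n)%N ->
  (forall b, b \in S -> w b <= d) -> weight w S <= n%:R * d.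
Proof.
move=> d0 Sn wd; apply: (@le_trans _ _ ((size S)%:R * d)); last first.
  by rewrite ler_wpM2r // ler_nat.
rewrite mulr_natl -[size S]count_predT -iter_addr_0 -big_const_seq.
by rewrite /weight big_seq [leRHS]big_seq; apply: ler_sum.
Qed.

(** This is the weight argument for two arbitrary trees on the same keys, with the path length in
    the access lemma already bounded below by 0. *)
Lemma descendants_turned_ancestors (n s t : nat) (T T' : tree) (c : R)
    (L : seq nat) :
  bst_on (key_range n) T -> bst_on (key_range n) T' ->
  s \in key_range n -> t \in key_range n -> 0 <= c ->
  (forall w : nat -> R, (forall a, 0 < w a) ->
    0 <= sol_potential n w T - sol_potential n w T'
         + c * (1 + log2 (weight w (key_range n) / w s))) ->
  uniq L ->
  {in L, forall u, [/\ u \in keys (subtree t T), u != t &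
                       t \in keys (subtree u T')]} ->
  (size L)%:R <= c.
Proof.
move=> [bT kT] [bT' kT'] sn tn c0 access uL hL.
(* The keys that get weight 1. The key [t] stays heavy, so it makes the new subtree of each of its
   new ancestors heavy. *)
pose low a := (a \in keys (subtree t T)) && (a != t).
(* A subtree has at most [n] keys, so the logarithm of its weight exceeds that of its heaviest key
   by at most [K]. *)
pose K : R := log2 n%:R.
have n0 : (0 < n)%N by case: (n) sn.
have subK x U : bst U -> keys U =i key_range n ->
    (size (keys (subtree x U)) <= n)%N.
  move=> bU kU; rewrite -(size_iota 1 n).
  apply: uniq_leq_size; first exact/bst_uniq/bst_subtree.
  by move=> y /subtree_sub; rewrite kU.
(* The huge weight is [2 ^+ M], with logarithm [M]; the right side does not depend on [M]. *)
have bound (M : nat) : ((size L)%:R - c) * M%:R <= n%:R * K + c * (1 + K).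
  pose D : R := 2 ^+ M.
  have D1 : 1 <= D by rewrite exprn_ege1 // ler1n.
  have D0 : 0 < D by exact: lt_le_trans D1.
  have logD : log2 D = M%:R by exact: log2_exp.
  pose w a : R := if low a then 1 else D.
  have w1 a : 1 <= w a by rewrite /w; case: ifP.
  have w0 a : 0 < w a by exact: lt_le_trans (w1 a).
  have w0' a : 0 <= w a by exact: ltW.
  have wD a : w a <= D by rewrite /w; case: ifP.
  have logW S a (v : R) : 0 < v -> a \in S -> v <= w a ->
      log2 v <= log2 (weight w S).
    by move=> v0 aS va; apply: ler_log2 => //; apply: le_trans va (weight_ge _ _).
  have wpos S a : a \in S -> 0 < weight w S.
    by move=> aS; apply: lt_le_trans (w0 a) (weight_ge _ _).
  (* A heavy [x] has logarithm at most [K + M] before and at least [M] after. A light [x] has at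
     most [K] before, and after at least [M] if [x] is in [L], at least 0 otherwise. *)
  have term x : x \in key_range n ->
      log2 (weight w (keys (subtree x T)))
      - log2 (weight w (keys (subtree x T'))) <= K - (x \in L)%:R * M%:R.
    move=> xn.
    have xT : x \in keys (subtree x T) by apply: mem_subtree_root; rewrite ?kT.
    have xT' : x \in keys (subtree x T').
      by apply: mem_subtree_root; rewrite ?kT'.
    case lx: (low x); last first.
      have -> : (x \in L) = false.
        by apply/negP => /hL[h1 h2 _]; rewrite /low h1 h2 in lx.
      have h1 : log2 (weight w (keys (subtree x T))) <= K + M%:R.
        rewrite -logD -log2M ?ltr0n //; apply: ler_log2; first exact: wpos xT.
        by apply: weight_le; rewrite ?(ltW D0) ?subK.
      have h2 : M%:R <= log2 (weight w (keys (subtree x T'))).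
        by rewrite -logD; apply: logW xT' _; rewrite // /w lx.
      by rewrite mul0r; lra.
    have {}lx : x \in keys (subtree t T) /\ x != t by apply/andP.
    have h1 : log2 (weight w (keys (subtree x T))) <= K.
      apply: ler_log2; first exact: wpos xT.
      rewrite -[leRHS]mulr1; apply: weight_le; rewrite ?subK // => b bx.
      rewrite /w ifT // /low (subtree_trans bT lx.1 bx) /=.
      (* If [b] were [t], then [x] and [t] would lie in each other's subtrees and coincide; hence
         all keys below [x] are light. *)
      apply: contraTneq isT => bt; move: bx; rewrite bt => tx.
      by case/eqP: lx.2; apply: (subtree_antisym bT _ tx lx.1); rewrite kT.
    have h2 : (x \in L)%:R * M%:R <= log2 (weight w (keys (subtree x T'))).
      case xL: (x \in L); rewrite ?mul1r ?mul0r.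
        have [_ _ tx] := hL _ xL.
        by rewrite -logD; apply: logW tx _; rewrite // /w /low eqxx andbF.
      have -> : 0 = log2 1 :> R by rewrite /log2 ln1 mul0r.
      exact: logW xT' _.
    by lra.
  have sumL : \sum_(x <- key_range n) (x \in L)%:R = (size L)%:R :> R.
    rewrite -natr_sum; congr (_%:R).
    have -> : size L = count [in L] (key_range n).
      rewrite -size_filter; apply/perm_size/uniq_perm => //.
        exact/filter_uniq/iota_uniq.
      move=> x; rewrite mem_filter; case xL: (x \in L) => //=.
      by have [/subtree_sub + _ _] := hL _ xL; rewrite kT => ->.
    by rewrite -sum1_count [RHS]big_mkcond.
  have drop : sol_potential n w T - sol_potential n w T'
      <= n%:R * K - (size L)%:R * M%:R.
    rewrite /sol_potential -sumrB big_seq.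
    apply: le_trans (ler_sum _ (fun x xn => term x xn)) _.
    rewrite -big_seq sumrB -[X in _ - X]mulr_suml sumL.
    by rewrite big_const_seq count_predT size_iota iter_addr_0 mulr_natl.
  (* The total weight is at most [n * D], and [w s] is at least 1. *)
  have cost : log2 (weight w (key_range n) / w s) <= K + M%:R.
    rewrite -logD -log2M ?ltr0n //; apply: ler_log2.
      by rewrite divr_gt0 // (wpos _ s).
    apply: (@le_trans _ _ (weight w (key_range n))).
      by rewrite ler_pdivrMr // ler_peMr // ltW // (wpos _ s).
    by apply: weight_le; rewrite ?(ltW D0) ?size_iota.
  have := access w w0.
  have : c * (1 + log2 (weight w (key_range n) / w s)) <= c * (1 + (K + M%:R)).
    by rewrite ler_wpM2l // lerD2l.
  by lra.
(* If [c] were below the length of [L], the left side of [bound] would be unbounded in [M]; an [M]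
   beyond the quotient of the two constants gives the contradiction. *)
rewrite leNgt; apply/negP => cL.
have e0 : 0 < (size L)%:R - c by rewrite subr_gt0.
have := bound (Num.bound `|(n%:R * K + c * (1 + K)) / ((size L)%:R - c)|).
rewrite mulrC -ler_pdivlMr // leNgt => /negP; apply.
exact: le_lt_trans (ler_norm _) (archi_boundP (normr_ge0 _)).
Qed.

End Potential.

(** * From the access lemma to bounded depth *)

Theorem theorem2 (R : realType) (alg : msa_algorithm)
    (halg : access_lemma_via_sol R alg) :
  exists C : nat,
  forall (n : nat) (T : tree) (s : nat) (A : tree),
    bst_on (key_range n) T -> s \in key_range n -> after_tree alg T s A ->
    forall t : nat, t \in keys A ->
      (s < t -> right_depth t A <= C) /\ (t < s -> left_depth t A <= C).
Proof.
have [c' access] := halg.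
(* Raising [c'] to a nonnegative constant keeps the access inequality, because its factor is
   nonnegative ([cost0]: the total weight is at least [w s]). *)
pose c : R := Num.max c' 0%R.
have c0 : (0 <= c)%R by rewrite le_max lexx orbT.
exists (Num.bound c) => n T s A hT sn hA t tA.
have [[bA kA] rootA] := after_treeP hT sn hA.
have hT' := bst_on_reattach hT (conj bA kA).
have tp : t \in search_path s T by rewrite -kA.
have tT : t \in keys T by exact: search_path_sub tp.
have tn : t \in key_range n by rewrite -(hT.2 t).
(* Treats both sides of [s] at once: such keys lie strictly below [t] in [T] and above [t] after the
   access. *)
have ancestors L : uniq L -> {subset L <= search_path t A} ->
    {in L, forall u, (s <= u < t) || (t < u <= s)} -> size L <= Num.bound c.
  move=> uL subL betweenL.
  suff: ((size L)%:R <= c)%R.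
    by move=> /le_lt_trans/(_ (archi_boundP c0)); rewrite ltr_nat => /ltnW.
  apply: (descendants_turned_ancestors hT hT' sn tn c0 _ uL) => [w w0|u uL'].
    have cost0 : (0 <= 1 + log2 (weight w (key_range n) / w s))%R.
      rewrite addr_ge0 // divr_ge0 ?ln_ge0 ?ler1n // ler_pdivlMr // mul1r.
      by apply: weight_ge => // b; rewrite ltW.
    have := access n T w s A hT (fun a _ => w0 a) sn hA.
    move/(le_trans (ler0n _ _))/le_trans; apply.
    by rewrite lerD2l ler_wpM2r // le_max lexx.
  have uA := subL _ uL'; have between_u := betweenL _ uL'.
  have uP : u \in search_path s T by rewrite -kA; exact: search_path_sub uA.
  split; first exact: search_path_between hT.1 tp uP between_u.
    by move: between_u; case: eqP => // ->; rewrite ltnn andbF.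
  apply: subtree_graft => //; first by rewrite kA.
  exact: mem_subtree_search_path.
have filter_path (p : pred nat) : {subset [seq u <- search_path t A | p u]
    <= search_path t A} by apply: mem_subseq; exact: filter_subseq.
split=> [st|ts].
  rewrite right_depthE //; apply: ancestors => //.
    exact/filter_uniq/search_path_uniq.
  move=> u; rewrite mem_filter => /andP[-> /(search_path_root bA rootA)[su _]].
  by rewrite su.
rewrite left_depthE //; apply: ancestors => //.
  exact/filter_uniq/search_path_uniq.
move=> u; rewrite mem_filter => /andP[-> /(search_path_root bA rootA)[_ us]].
by rewrite us ?orbT.
Qed.
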